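(* Let $k\geq 3$ and let $a,b,c$ be integers with $1<a<b<c$ and $a^k<b<c$. Then $\{a^k,b,c\}$ is not a $k$-th power Diophantine triple; that is, it is not the case that each of $a^k b+1$, $a^k c+1$ and $bc+1$ is a perfect $k$-th power of an integer.
   Context: For an integer $k\geq 3$, a set of positive integers $\{a_1,\dots,a_m\}$ is called a $k$-th power Diophantine $m$-tuple if $a_ia_j+1$ is a perfect $k$-th power (of an integer) for all $1\leq i<j\leq m$. *)

(* Defs.v *)
From mathcomp Require Import all_boot all_order all_algebra.
Set Implicit Arguments. Unset Strict Implicit. Unset Printing Implicit Defensive.
Import GRing.Theory Num.Theory.
Local Open Scope ring_scope.

Definition is_kth_power (k : nat) (n : int) : Prop := exists x : int, n = x ^+ k.

Definition kth_dioph_triple (k : nat) (x y z : int) : Prop :=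
  is_kth_power k (x * y + 1) /\ is_kth_power k (x * z + 1) /\ is_kth_power k (y * z + 1).

(* Main.v *)
(* Put A = a^k, D = A b, w = a^2 z, where x^k = A b + 1 = D + 1, y^k = A c + 1 and
   z^k = b c + 1. Then D y^k = w^k + (D - A^2) with 0 < D - A^2 < D, so w / y is an
   extremely good rational approximation from below to (x^k - 1)^(1/k) =
   x (1 - x^-k)^(1/k). The diagonal Pade approximants to u^(1/k) at u = 1, evaluated
   at u = 1 - x^-k, are good approximations from above with controlled denominators
   (Thue-Siegel hypergeometric method), hence they differ from w / y. For every n this
   yields an inequality which excludes all w of size about D^(n + 1); the excluded ranges
   overlap and cover everything, since w^k > D^2 and D is not too small. *)
Require Import Defs.
From mathcomp Require Import all_boot all_order all_algebra.
From mathcomp Require Import ring lra zify.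
From mathcomp Require Import functions reals topology normedtype derive realfun exp Rstruct.
Set Implicit Arguments. Unset Strict Implicit. Unset Printing Implicit Defensive.
Import Order.TTheory GRing.Theory Num.Theory.
Import numFieldNormedType.Exports.
Local Open Scope ring_scope.

(** * Generalized binomial coefficients *)

Section GeneralizedBinomials.
Variable F : numFieldType.
Implicit Types (x y : F) (j m n : nat).

Definition gbin x j : F := (\prod_(i < j) (x - i%:R)) / j`!%:R.

Lemma gbin0 x : gbin x 0 = 1.
Proof. by rewrite /gbin big_ord0 fact0 divr1. Qed.

Lemma gbinS x j : j.+1%:R * gbin x j.+1 = (x - j%:R) * gbin x j.
Proof.
have h1 : j`!%:R != 0 :> F by rewrite pnatr_eq0 -lt0n fact_gt0.
have h2 : j.+1%:R != 0 :> F by rewrite pnatr_eq0.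
rewrite /gbin big_ord_recr /= factS natrM; field.
by rewrite h1 addrC natr1 h2.
Qed.

Lemma gbinSS x j : j.+1%:R * gbin (x + 1) j.+1 = (x + 1) * gbin x j.
Proof.
have h1 : j`!%:R != 0 :> F by rewrite pnatr_eq0 -lt0n fact_gt0.
have h2 : j.+1%:R != 0 :> F by rewrite pnatr_eq0.
rewrite /gbin big_ord_recl /= factS natrM.
under eq_bigr => i _ do rewrite /bump /= natrD opprD addrA addrK.
field.
by rewrite h1 addrC natr1 h2.
Qed.

Lemma gbin_nat n j : gbin n%:R j = 'C(n, j)%:R.
Proof.
elim: j => [|j IHj]; first by rewrite gbin0 bin0.
apply: (@mulfI _ j.+1%:R); first by rewrite pnatr_eq0.
rewrite gbinS IHj -natrM mul_bin_left natrM.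
case: (leqP j n) => [le_jn|lt_nj]; first by rewrite natrB.
by rewrite bin_small // !mulr0.
Qed.

Lemma gbin_gt0 x j : j%:R < x + 1 -> 0 < gbin x j.
Proof.
move=> lt_jx; rewrite /gbin divr_gt0 ?ltr0n ?fact_gt0 //.
apply: prodr_gt0 => i _; rewrite subr_gt0 -(ltrD2r 1).
by apply: le_lt_trans lt_jx; rewrite natr1 ler_nat.
Qed.

(** Induction after multiplying by [m.+1], split as [j + (m.+1 - j)]: [gbinS] applies to one factor
    in each half, and the halves recombine by [(x - j) + (y - (m - j)) = x + y - m]. *)
Lemma gbin_Vandermonde x y m :
  \sum_(j < m.+1) gbin x j * gbin y (m - j) = gbin (x + y) m.
Proof.
elim: m => [|m IHm]; first by rewrite big_ord1 !gbin0 mulr1.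
apply: (@mulfI _ m.+1%:R); first by rewrite pnatr_eq0.
rewrite gbinS -IHm !mulr_sumr.
transitivity (\sum_(j < m.+2) (j%:R * gbin x j * gbin y (m.+1 - j)
                + gbin x j * ((m.+1 - j)%:R * gbin y (m.+1 - j)))).
  apply: eq_bigr => j _; have le_jm : (j <= m.+1)%N by rewrite -ltnS.
  by rewrite natrB //; ring.
rewrite big_split /= big_ord_recl /= !mul0r add0r.
rewrite [X in _ + X]big_ord_recr /= subnn mul0r mulr0 addr0 -big_split /=.
apply: eq_bigr => j _; have le_jm : (j <= m)%N by rewrite -ltnS.
rewrite /bump /= add1n subSS gbinS subSn // gbinS natrB //; ring.
Qed.

End GeneralizedBinomials.

(** * Hypergeometric polynomials and the Pade approximants of [u ^ nu] *)

Section PadeApproximants.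
Variable F : realFieldType.
Implicit Types (x y nu u : F) (j m n : nat).

(** At [u] this is [(1 - u) ^ n] times the classical Jacobi polynomial with parameters
    [(y - n, x - n)] at [(1 + u) / (1 - u)]. *)
Definition jacobi x y n : {poly F} := \poly_(j < n.+1) (gbin x j * gbin y (n - j)).

Lemma coef_jacobiS x y n j :
  j.+1%:R * (y - n%:R + j.+1%:R) * (jacobi x y n)`_j.+1 =
  (n%:R - j%:R) * (x - j%:R) * (jacobi x y n)`_j.
Proof.
rewrite !coef_poly !ltnS; case: (ltngtP j n) => [lt_jn|lt_nj|->]; last 2 first.
- by rewrite !mulr0.
- by rewrite subrr !mul0r mulr0.
have le_jn := ltnW lt_jn.
have := gbinS y (n - j.+1); rewrite -subSn // subSS !natrB // => Ey.
have := gbinS x j => Ex.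
transitivity ((j.+1%:R * gbin x j.+1) * ((y - (n%:R - j.+1%:R)) * gbin y (n - j.+1))).
  by ring.
rewrite Ex -Ey; ring.
Qed.

(* Gauss' hypergeometric equation with parameters [-n], [-x] and [y - n + 1]. *)
Lemma jacobi_ode x y n :
  'X * (1 - 'X) * (jacobi x y n)^`()^`()
  + ((y - n%:R + 1)%:P + (n%:R + x - 1) *: 'X) * (jacobi x y n)^`()
  - (n%:R * x) *: jacobi x y n = 0.
Proof.
apply/polyP => j.
have := coef_jacobiS x y n j; set c := jacobi x y n => Ec.
rewrite -!mul_polyC.
set s := (y - _ + 1); set t := (n%:R + x - 1); set r := _ * x.
have -> : 'X * (1 - 'X) * c^`()^`() + (s%:P + t%:P * 'X) * c^`() - r%:P * c =
  'X * c^`()^`() - 'X * ('X * c^`()^`()) + (s%:P * c^`() + t%:P * ('X * c^`()))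
  - r%:P * c by ring.
rewrite !(coefD, coefN, coefB, coefCM, coefXM, coef_deriv, coef0) /s /t /r.
rewrite -[RHS](subrr (j.+1%:R * (y - n%:R + j.+1%:R) * c`_j.+1)) {2}Ec.
case: j Ec => [|[|j]] _ /=; ring.
Qed.

(** The solutions are the multiples of [(1 - 'X) ^+ m], fixed by their constant term: coefficient
    [j] of the equation determines [d_(j+1)] from [d_j]. *)
Lemma poly_ode_unique m (d : {poly F}) :
  (1 - 'X) * d^`() + m%:R *: d = 0 -> d`_0 = 0 -> d = 0.
Proof.
move=> /polyP ode d0; apply/polyP => j; rewrite coef0.
elim: j => // j IHj; move: (ode j).
rewrite mulrBl mul1r !(coefD, coefN, coefZ, coefXM, coef_deriv, coef0) IHj mulr0 addr0.
have -> : (if j == 0 then 0 else d`_j.-1.+1 *+ j.-1.+1) = 0.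
  by case: j IHj => //= j ->; rewrite mul0rn.
by rewrite subr0 => /eqP; rewrite mulrn_eq0 /= => /eqP.
Qed.

(* [padeP nu n / padeQ nu n] is the diagonal Pade approximant to [u ^ nu] at [u = 1], written
   in powers of [u] rather than [1 - u] so that all coefficients are positive. *)
Definition padeQ nu n := jacobi (n%:R - nu) (n%:R + nu) n.
Definition padeP nu n := jacobi (n%:R + nu) (n%:R - nu) n.

(** This is [u ^ (1 - nu)] times the Wronskian of [padeP nu n] and [u ^ nu * padeQ nu n]; the factor
    makes it a polynomial. *)
Definition pade_wronskian nu n : {poly F} :=
  'X * (padeP nu n * (padeQ nu n)^`() - (padeP nu n)^`() * padeQ nu n)
  + nu *: (padeP nu n * padeQ nu n).

(* [padeP nu n] and [u ^ nu * padeQ nu n] solve the same hypergeometric equation; this is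
   Abel's formula for their Wronskian. *)
Lemma pade_wronskianE nu n :
  pade_wronskian nu n =
  (nu * (gbin (n%:R - nu) n * gbin (n%:R + nu) n)) *: (1 - 'X) ^+ (2 * n).
Proof.
apply/eqP; rewrite -subr_eq0; apply/eqP.
apply: (@poly_ode_unique (2 * n)); last first.
  rewrite -horner_coef0 /pade_wronskian !(hornerD, hornerN, hornerZ, hornerM, hornerX).
  rewrite horner_exp !(hornerD, hornerN, hornerC, hornerX) subr0 expr1n.
  by rewrite !horner_coef0 !coef_poly /= subn0 !gbin0; ring.
have eQ := jacobi_ode (n%:R - nu) (n%:R + nu) n.
have eP := jacobi_ode (n%:R + nu) (n%:R - nu) n.
rewrite derivB derivZ scalerBr mulrBr addrACA -opprD.
(* [E] comes from [(1 - 'X) ^+ (2 * n)], itself a solution. The Wronskian part is [padeP] times the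
   equation of [padeQ] minus [padeQ] times that of [padeP]. *)
set E := (X in _ - X); suff -> : E = 0.
  rewrite subr0 /pade_wronskian -/(padeP nu n) -/(padeQ nu n).
  rewrite -/(padeP nu n) in eP; rewrite -/(padeQ nu n) in eQ.
  set p := padeP nu n in eP *; set q := padeQ nu n in eQ *.
  transitivity (p * 0 - q * 0); last by rewrite !mulr0 subrr.
  rewrite -{1}eQ -eP !(derivD, derivN, derivB, derivM, derivZ, derivX) -!mul_polyC; ring.
have d1 : (1 : {poly F})^`() = 0 by rewrite -polyC1 derivC.
rewrite /E scaler_nat deriv_exp derivB derivX d1 -!mul_polyC.
case: n {eQ eP E} => [|n]; first by rewrite muln0 mulr0n; ring.
have -> : (2 * n.+1 = (2 * n).+2)%N by rewrite mulnS.
by rewrite /= !exprS; ring.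
Qed.

Lemma padeP1 nu n : (padeP nu n).[1] = 'C(2 * n, n)%:R.
Proof.
rewrite /padeP /jacobi horner_poly.
under eq_bigr => j _ do rewrite expr1n mulr1.
by rewrite gbin_Vandermonde addrACA subrr addr0 -natrD addnn -mul2n gbin_nat.
Qed.

Lemma padeQ1 nu n : (padeQ nu n).[1] = 'C(2 * n, n)%:R.
Proof.
rewrite /padeQ /jacobi horner_poly.
under eq_bigr => j _ do rewrite expr1n mulr1.
by rewrite gbin_Vandermonde addrACA addNr addr0 -natrD addnn -mul2n gbin_nat.
Qed.

Lemma gbin_pade_gt0 nu n j : `|nu| < 1 -> (j <= n)%N -> 0 < gbin (n%:R + nu) j.
Proof.
move=> nu1 le_jn; apply: gbin_gt0; rewrite -addrA.
have : 0 < nu + 1 by rewrite -ltrBlDr sub0r; move: nu1; rewrite ltr_norml => /andP[].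
move=> nu1_gt0; apply: (@le_lt_trans _ _ n%:R); first by rewrite ler_nat.
by rewrite ltrDl.
Qed.

(** The coefficients are nonnegative and [u ^+ n <= u ^+ j <= 1] for [j <= n]. *)
Lemma jacobi_bounds x y n u :
  (forall j, (j <= n)%N -> 0 < gbin x j /\ 0 < gbin y j) -> 0 <= u <= 1 ->
  (jacobi x y n).[1] * u ^+ n <= (jacobi x y n).[u] <= (jacobi x y n).[1].
Proof.
move=> xy_gt0 /andP[u0 u1]; rewrite /jacobi !horner_poly mulr_suml.
under [in X in X && _]eq_bigr => j _ do rewrite expr1n mulr1.
under [X in _ && (_ <= X)]eq_bigr => j _ do rewrite expr1n mulr1.
have c_ge0 (j : 'I_n.+1) : 0 <= gbin x j * gbin y (n - j).
  have /xy_gt0[hx _] : (j <= n)%N by rewrite -ltnS.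
  by have /xy_gt0[_ hy] := leq_subr j n; rewrite mulr_ge0 ?ltW.
apply/andP; split; apply: ler_sum => j _.
  by apply: ler_wpM2l => //; apply: ler_wiXn2l => //; rewrite -ltnS.
by apply: ler_piMr => //; apply: exprn_ile1.
Qed.

(* The product is [\prod_(1 <= i <= n) (1 - nu^2 / i^2)]. *)
Lemma gbin_pade_le1 nu n : `|nu| < 1 ->
  gbin (n%:R - nu) n * gbin (n%:R + nu) n <= 1.
Proof.
move=> nu1; elim: n => [|n IHn]; first by rewrite !gbin0 mulr1.
have E1 := gbinSS (n%:R - nu) n; have E2 := gbinSS (n%:R + nu) n.
have h1 : n.+1%:R - nu = n%:R - nu + 1 by rewrite -natr1; ring.
have h2 : n.+1%:R + nu = n%:R + nu + 1 by rewrite -natr1; ring.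
rewrite h1 h2 -(@ler_pM2l _ (n.+1%:R ^+ 2)) ?exprn_gt0 ?ltr0n // mulr1.
have -> : n.+1%:R ^+ 2 * (gbin (n%:R - nu + 1) n.+1 * gbin (n%:R + nu + 1) n.+1)
  = (n.+1%:R * gbin (n%:R - nu + 1) n.+1) * (n.+1%:R * gbin (n%:R + nu + 1) n.+1) by ring.
rewrite E1 E2 -h1 -h2.
have -> : (n.+1%:R - nu) * gbin (n%:R - nu) n * ((n.+1%:R + nu) * gbin (n%:R + nu) n)
  = (n.+1%:R ^+ 2 - nu ^+ 2) * (gbin (n%:R - nu) n * gbin (n%:R + nu) n) by ring.
have nu2 : 0 <= nu ^+ 2 by exact: sqr_ge0.
apply: (@le_trans _ _ (n.+1%:R ^+ 2 - nu ^+ 2)); last by rewrite gerBl.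
apply: ler_piMr => //; rewrite subr_ge0 -real_normK ?num_real //.
by apply: lerXn2r; rewrite ?nnegrE ?ler0n // (le_trans (ltW nu1)) // ler1n.
Qed.

End PadeApproximants.

(** * Denominators of the Pade approximants *)

Lemma dvdz_prodB (g : int) (j : nat) (f h : nat -> int) :
  (forall i, (g %| f i - h i)%Z) -> (g %| \prod_(i < j) f i - \prod_(i < j) h i)%Z.
Proof.
move=> fh; elim: j => [|j IHj]; first by rewrite !big_ord0 subrr dvdz0.
rewrite !big_ord_recr /=; set a := \prod_(i < j) f i in IHj *; set b := \prod_(i < j) h i in IHj *.
have -> : a * f j - b * h j = (a - b) * f j + b * (f j - h j) by ring.
by rewrite rpredD // ?(dvdz_mulr _ IHj) // dvdz_mull.
Qed.

(** Replacing [t] by its residue [m] modulo [j!] turns the product into the falling factorial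
    ['C(m, j) * j!], also for negative [t]. *)
Lemma dvdz_fact_prod (t : int) (j : nat) : (j`!%:Z %| \prod_(i < j) (t - i%:Z))%Z.
Proof.
have j0 : j`!%:Z != 0 :> int by rewrite eqz_nat -lt0n fact_gt0.
pose m := `|(t %% j`!%:Z)%Z|%N.
have mE : m%:Z = (t %% j`!%:Z)%Z by rewrite /m gez0_abs // modz_ge0.
have h : (j`!%:Z %| \prod_(i < j) (t - i%:Z) - \prod_(i < j) (m%:Z - i%:Z))%Z.
  apply: (@dvdz_prodB _ _ (fun i => t - i%:Z) (fun i => m%:Z - i%:Z)) => i.
  have -> : t - i%:Z - (m%:Z - i%:Z) = (t %/ j`!%:Z)%Z * j`!%:Z.
    by rewrite mE {1}(divz_eq t j`!%:Z); ring.
  exact: dvdz_mull.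
have hm : \prod_(i < j) (m%:Z - i%:Z) = (m ^_ j)%:Z.
  have [le_jm|lt_mj] := leqP j m.
    rewrite ffact_prod -[RHS]natz natr_prod; apply: eq_bigr => i _.
    by rewrite natz subzn //; apply: leq_trans le_jm; exact: ltnW.
  rewrite ffact_small // (bigD1 (Ordinal lt_mj)) //=.
  by rewrite subrr mul0r.
have : (j`!%:Z %| \prod_(i < j) (m%:Z - i%:Z))%Z.
  by rewrite hm -bin_ffact dvdzE /= dvdn_mull.
by move/(rpredD h); rewrite subrK.
Qed.

(** With [u] an inverse of [k] modulo [g], multiplying by [u ^+ j], which is prime to [g], makes the
    progression one of consecutive integers modulo [g]. *)
Lemma dvdz_prod_progression (g k : int) (j : nat) (c : int) :
  coprimez k g -> (g %| j`!%:Z)%Z -> (g %| \prod_(i < j) (c - k * i%:Z))%Z.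
Proof.
move=> /coprimezP[[u v] /= bez] gj.
have ug : coprimez g (u ^+ j).
  by rewrite coprimez_sym coprimezXl //; apply/coprimezP; exists (k, v); rewrite /= -bez; ring.
rewrite -(Gauss_dvdzr _ ug).
have -> : u ^+ j * \prod_(i < j) (c - k * i%:Z) = \prod_(i < j) (u * (c - k * i%:Z)).
  by rewrite big_split /= prodr_const card_ord.
have h := @dvdz_prodB g j (fun i => u * (c - k * i%:Z)) (fun i => u * c - i%:Z).
rewrite -[X in (_ %| X)%Z](subrK (\prod_(i < j) (u * c - i%:Z))) rpredD //.
  apply: h => i; have -> : u * (c - k * i%:Z) - (u * c - i%:Z) = (1 - u * k) * i%:Z by ring.
  by rewrite -bez addrAC subrr add0r -mulrA mulrC -mulrA dvdz_mulr.
exact: dvdz_trans gj (dvdz_fact_prod _ _).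
Qed.

(** The part of [n!] prime to [k] cancels in a binomial coefficient of [c / k], so only the part at
    the primes dividing [k] is kept. *)
Definition pade_denom (k n : nat) : nat := (k ^ n * n`!`_\pi(k))%N.

Lemma gbin_int (F : numFieldType) (k : nat) (c : int) (j : nat) : (0 < k)%N ->
  exists z : int, (pade_denom k j)%:R * gbin (c%:~R / k%:R : F) j = z%:~R.
Proof.
move=> k0.
have h : ((j`!`_(\pi(k)^'))%N%:Z %| \prod_(i < j) (c - k%:Z * i%:Z))%Z.
  apply: dvdz_prod_progression; last by rewrite dvdzE /= dvdn_part.
  by rewrite /coprimez /gcdz /= eqz_nat -/(coprime _ _) coprime_pi'  ?part_gt0 // part_pnat.
have [z Ez] := dvdzP h; exists z.
have kF : k%:R != 0 :> F by rewrite pnatr_eq0 -lt0n.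
have pj : (j`!`_(\pi(k)^'))%N%:R != 0 :> F by rewrite pnatr_eq0 -lt0n part_gt0.
apply: (@mulIf _ (j`!`_(\pi(k)^'))%N%:R) => //.
rewrite [X in _ = _ * X]pmulrn -intrM -Ez.
rewrite /gbin /pade_denom natrM.
have -> : (k ^ j)%:R * (j`!`_\pi(k))%:R * (\prod_(i < j) (c%:~R / k%:R - i%:R) / j`!%:R)
   * (j`!`_(\pi(k)^'))%:R = (k%:R ^+ j * \prod_(i < j) (c%:~R / k%:R - i%:R))
   * ((j`!`_\pi(k))%:R * (j`!`_(\pi(k)^'))%:R / j`!%:R) :> F by rewrite natrX; ring.
rewrite -natrM partnC ?fact_gt0 // divff ?mulr1; last by rewrite pnatr_eq0 -lt0n fact_gt0.
rewrite rmorph_prod /= -[j in k%:R ^+ j]card_ord -prodr_const -big_split /=.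
by apply: eq_bigr => i _; rewrite rmorphB rmorphM /= -!pmulrn; field.
Qed.

Lemma jacobi_int (F : realFieldType) (k n : nat) (c1 c2 : int) (d b : nat) :
  (0 < k)%N -> (0 < b)%N -> exists z : int,
  (pade_denom k n)%:R * b%:R ^+ n *
    (jacobi (c1%:~R / k%:R : F) (c2%:~R / k%:R) n).[d%:R / b%:R] = z%:~R.
Proof.
move=> k0 b0; rewrite /jacobi horner_poly mulr_sumr.
apply: (big_ind (fun s : F => exists z : int, s = z%:~R)).
- by exists 0.
- by move=> _ _ [z1 ->] [z2 ->]; exists (z1 + z2); rewrite rmorphD.
move=> j _; have le_jn : (j <= n)%N by rewrite -ltnS.
have [z1 E1] := gbin_int F c1 j k0; have [z2 E2] := gbin_int F c2 (n - j) k0.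
exists (z1 * z2 * ('C(n, j)`_\pi(k))%:Z * d%:Z ^+ j * b%:Z ^+ (n - j)).
rewrite !intrM !rmorphXn /= -E1 -E2 -!pmulrn.
have bF : b%:R != 0 :> F by rewrite pnatr_eq0 -lt0n.
(* As [n!] is ['C(n, j)] times [j!] times [(n - j)!], a single [pade_denom k n] clears both binomial
   factors. *)
have -> : pade_denom k n = (pade_denom k j * pade_denom k (n - j) * 'C(n, j)`_\pi(k))%N.
  rewrite /pade_denom -(bin_fact le_jn) partnM ?bin_gt0 ?muln_gt0 ?fact_gt0 //.
  by rewrite partnM ?fact_gt0 // -{1}(subnKC le_jn) expnD; lia.
have -> : b%:R ^+ n = b%:R ^+ j * b%:R ^+ (n - j) :> F by rewrite -exprD subnKC.
rewrite expr_div_n !natrM; field.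
by rewrite expf_neq0.
Qed.

Lemma logn_fact_le (p n : nat) : prime p -> (p.-1 * logn p n`! <= n)%N.
Proof.
move=> pp; rewrite logn_fact //.
(* Partial sums of Legendre's formula; the extra term [n %/ p ^ m] makes the induction telescope. *)
have h m : (p.-1 * (\sum_(1 <= i < m.+1) n %/ p ^ i) + n %/ p ^ m <= n)%N.
  elim: m => [|m IHm]; first by rewrite big_geq // muln0 divn1.
  apply: leq_trans IHm; rewrite big_nat_recr //= mulnDr -addnA leq_add2l.
  rewrite addnC -mulSn prednK ?prime_gt0 // expnSr divnMA mulnC.
  exact: leq_trunc_div.
by apply: leq_trans (h n); exact: leq_addr.
Qed.

(** Each prime dividing [k] has exponent at most [n] in [n!], so the retained part of [n!] divides
    [k ^ n]. *)
Lemma pade_denom_le (k n : nat) : (0 < k)%N -> (pade_denom k n <= k ^ (2 * n))%N.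
Proof.
move=> k0; rewrite mul2n -addnn expnD leq_mul2l; apply/orP; right.
apply: dvdn_leq; first by rewrite expn_gt0 k0.
apply/dvdn_partP; first exact: part_gt0.
move=> p; rewrite pi_of_part ?fact_gt0 // inE /= => /andP[_ pk].
rewrite partn_part; last by move=> r /[!inE] /eqP->.
have [pp _ pdk] : [/\ prime p, (0 < k)%N & (p %| k)%N] by move: pk; rewrite mem_primes => /and3P[].
rewrite p_part; apply: dvdn_trans (dvdn_exp2r n pdk); apply: dvdn_exp2l.
apply: leq_trans (logn_fact_le n pp); rewrite leq_pmull //.
by have := prime_gt1 pp; lia.
Qed.

Lemma pade_denom3 n : pade_denom 3 n = (3 ^ (n + logn 3 n`!))%N.
Proof.
rewrite /pade_denom expnD; congr (_ * _)%N.
by rewrite -p_part; apply: eq_partn => p; rewrite pi_of_prime.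
Qed.

(** The exponent of 3 in [n!] is at most [n / 2], which improves the general bound [9 ^ n]; the
    square avoids a half-integral exponent. *)
Lemma pade_denom3_le n : (pade_denom 3 n ^ 2 <= 27 ^ n)%N.
Proof.
rewrite pade_denom3 -expnM (_ : 27 = 3 ^ 3)%N // -expnM leq_exp2l //.
by have := @logn_fact_le 3 n isT; rewrite /=; lia.
Qed.

(** * Error of the Pade approximants *)

Section PadeError.
Variable R : realType.

Lemma ge0_is_derive_le (f df : R -> R) (a b : R) : a <= b ->
  (forall x, a <= x <= b -> is_derive x 1 f (df x)) ->
  (forall x, a <= x <= b -> 0 <= df x) -> f a <= f b.
Proof.
move=> le_ab fdf df_ge0.
have [x xab||c + E] := @MVT_segment R f df a b le_ab.
- by apply: fdf; move: xab; rewrite in_itv /= => /andP[/ltW-> /ltW->].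
- apply: derivable_within_continuous => x; rewrite in_itv /= => xab.
  by case: (fdf x xab).
- by rewrite in_itv /= => cab; rewrite -subr_ge0 E mulr_ge0 ?df_ge0 ?subr_ge0.
Qed.

Lemma is_derive_horner (p : {poly R}) (x : R) : is_derive x 1 (horner p) p^`().[x].
Proof.
apply: DeriveDef; first exact: derivable_horner.
by rewrite derivE derive1E.
Qed.

Lemma is_derive_ln_horner (p : {poly R}) (x : R) : 0 < p.[x] ->
  is_derive x 1 (fun v => ln p.[v]) (p.[x]^-1 * p^`().[x]).
Proof.
move=> px; apply: (@is_derive1_comp R (@ln R) (horner p)).
exact: is_derive1_ln.
Qed.

Variables (k n : nat).
Hypothesis k_gt1 : (1 < k)%N.
Let nu : R := k%:R^-1.
Let p : {poly R} := padeP nu n.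
Let q : {poly R} := padeQ nu n.
Let S : R := 'C(2 * n, n)%:R.

Let nu_lt1 : `|nu| < 1.
Proof. by rewrite ger0_norm ?invr_ge0 ?ler0n // invf_lt1 ?ltr1n // ltr0n; lia. Qed.

Let S_gt0 : 0 < S.
Proof. by rewrite ltr0n bin_gt0; lia. Qed.

Lemma padeP_bounds (u : R) : 0 <= u <= 1 -> S * u ^+ n <= p.[u] <= S.
Proof.
rewrite /S -(padeP1 nu); apply: jacobi_bounds => j le_jn; split.
  exact: gbin_pade_gt0.
by apply: gbin_pade_gt0; rewrite ?normrN.
Qed.

Lemma padeQ_bounds (u : R) : 0 <= u <= 1 -> S * u ^+ n <= q.[u] <= S.
Proof.
rewrite /S -(padeQ1 nu); apply: jacobi_bounds => j le_jn; split.
  by apply: gbin_pade_gt0; rewrite ?normrN.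
exact: gbin_pade_gt0.
Qed.

Lemma padeP_gt0 (u : R) : 0 < u <= 1 -> 0 < p.[u].
Proof.
move=> /andP[u0 u1]; have /andP[+ _] := @padeP_bounds u ltac:(by rewrite ltW).
by apply: lt_le_trans; rewrite mulr_gt0 ?exprn_gt0.
Qed.

Lemma padeQ_gt0 (u : R) : 0 < u <= 1 -> 0 < q.[u].
Proof.
move=> /andP[u0 u1]; have /andP[+ _] := @padeQ_bounds u ltac:(by rewrite ltW).
by apply: lt_le_trans; rewrite mulr_gt0 ?exprn_gt0.
Qed.

(** The logarithm of [(p / q) ^ k / u]: it measures the error of [p / q] as an approximation of
    [u ^ (1 / k)] without roots. *)
Definition pade_log (u : R) : R := k%:R * (ln p.[u] - ln q.[u]) - ln u.

Let kappa : R := gbin (n%:R - nu) n * gbin (n%:R + nu) n.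

Let kappa_gt0 : 0 < kappa.
Proof. by rewrite mulr_gt0 // gbin_pade_gt0 // normrN. Qed.

(* The numerator of the logarithmic derivative is the Wronskian computed above. *)
Lemma is_derive_pade_log (u : R) : 0 < u <= 1 ->
  is_derive u 1 pade_log (- (kappa * (1 - u) ^+ (2 * n) / (u * p.[u] * q.[u]))).
Proof.
move=> u01; have pu := padeP_gt0 u01; have qu := padeQ_gt0 u01.
have u0 : 0 < u by case/andP: u01.
have dp := is_derive_ln_horner pu; have dq := is_derive_ln_horner qu.
have dl := is_derive1_ln u0.
have k0 : k%:R != 0 :> R by rewrite pnatr_eq0; lia.
have d := is_deriveB (is_deriveZ k%:R (is_deriveB dp dq)) dl.
apply: (is_derive_eq d).
have := congr1 (horner^~ u) (pade_wronskianE nu n).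
rewrite /= /pade_wronskian -/p -/q !(hornerD, hornerN, hornerZ, hornerM, hornerX).
rewrite horner_exp !(hornerD, hornerN, hornerC, hornerX) => E.
have {}E : u * (p.[u] * q^`().[u] - p^`().[u] * q.[u]) * k%:R + p.[u] * q.[u]
  = kappa * (1 - u) ^+ (2 * n).
  apply: (@mulfI _ nu); first by rewrite invr_eq0.
  rewrite /kappa mulrA -E /nu; field.
  by [].
rewrite -E /GRing.scale /=; field.
by rewrite !gt_eqF.
Qed.

Lemma pade_log1 : pade_log 1 = 0.
Proof. by rewrite /pade_log /p /q padeP1 padeQ1 subrr mulr0 ln1 subr0. Qed.

(** The function is nonincreasing on [(0, 1]] and vanishes at 1, so the approximants lie above
    [u ^ (1 / k)]. *)
Lemma pade_log_ge0 (u : R) : 0 < u <= 1 -> 0 <= pade_log u.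
Proof.
move=> /andP[u0 u1]; rewrite -pade_log1 -lerN2.
have sub v : u <= v <= 1 -> 0 < v <= 1.
  by move=> /andP[uv ->]; rewrite (lt_le_trans u0).
apply: (@ge0_is_derive_le (- pade_log)
  (fun v => - - (kappa * (1 - v) ^+ (2 * n) / (v * p.[v] * q.[v])))) => // v uv.
  exact/is_deriveN/is_derive_pade_log/sub.
rewrite opprK; have v01 := sub v uv; case/andP: uv => _ v1.
have v0 : 0 < v by case/andP: v01.
have pv := padeP_gt0 v01; have qv := padeQ_gt0 v01.
apply: divr_ge0; last by rewrite ltW // !mulr_gt0.
by rewrite mulr_ge0 ?exprn_ge0 ?subr_ge0 // ltW.
Qed.

(** Comparison with a multiple [g] of [(1 - v) ^ (2n + 1)], also zero at 1. On [[u, 1]] it falls at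
    least as fast, since [kappa <= 1] and [v p(v) q(v) >= u (S u ^ n) ^ 2]. *)
Lemma pade_log_le (u : R) : 0 < u <= 1 ->
  pade_log u <= ((1 - u) / u) ^+ (2 * n).+1 / ((2 * n).+1%:R * S ^+ 2).
Proof.
move=> /andP[u0 u1].
have sub v : u <= v <= 1 -> 0 < v <= 1.
  by move=> /andP[uv ->]; rewrite (lt_le_trans u0).
pose K : R := ((2 * n).+1%:R * S ^+ 2 * u ^+ (2 * n).+1)^-1.
have n0 : 0 < (2 * n).+1%:R :> R by rewrite ltr0n.
have K0 : 0 < K by rewrite invr_gt0 !mulr_gt0 ?exprn_gt0.
rewrite expr_div_n (_ : _ / _ = K * (1 - u) ^+ (2 * n).+1); last first.
  by rewrite /K !invfM; ring.
pose g : {poly R} := K *: (1 - 'X) ^+ (2 * n).+1.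
have gE v : g.[v] = K * (1 - v) ^+ (2 * n).+1.
  by rewrite /g hornerZ horner_exp !(hornerD, hornerN, hornerC, hornerX).
have g'E v : g^`().[v] = - (K * (2 * n).+1%:R * (1 - v) ^+ (2 * n)).
  rewrite /g derivZ deriv_exp /= derivB derivX -polyC1 derivC sub0r.
  rewrite hornerZ hornerMn hornerM horner_exp !(hornerD, hornerN, hornerC, hornerX).
  ring.
have := @ge0_is_derive_le (pade_log - horner g)
  (fun v => - (kappa * (1 - v) ^+ (2 * n) / (v * p.[v] * q.[v])) - g^`().[v]) u 1 u1.
rewrite !fctE pade_log1 !gE subrr expr0n mulr0 subr0 subr_le0; apply.
  move=> v uv.
  exact: is_deriveB (is_derive_pade_log (sub v uv)) (is_derive_horner g v).
move=> v uv; have v01 := sub v uv; case/andP: (uv) => uv' v1.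
have v0 : 0 < v by case/andP: v01.
rewrite g'E opprK addrC subr_ge0 mulrAC; apply: ler_wpM2r.
  by rewrite exprn_ge0 ?subr_ge0.
have -> : K * (2 * n).+1%:R = (S ^+ 2 * u ^+ (2 * n).+1)^-1.
  by rewrite /K !invfM mulrC !mulrA mulfV ?mul1r // gt_eqF.
have pv := padeP_gt0 v01; have qv := padeQ_gt0 v01.
have pos : 0 < v * p.[v] * q.[v] by rewrite !mulr_gt0.
apply: (@le_trans _ _ (v * p.[v] * q.[v])^-1).
  apply: ler_piMl; first by rewrite invr_ge0 ltW.
  exact: gbin_pade_le1.
rewrite lef_pV2 ?posrE ?mulr_gt0 ?exprn_gt0 //.
have -> : S ^+ 2 * u ^+ (2 * n).+1 = u * (S * u ^+ n) * (S * u ^+ n).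
  by rewrite [u ^+ _]exprS [(2 * n)%N]mulnC exprM; ring.
have bnd (r : {poly R}) : (forall w, 0 <= w <= 1 -> S * w ^+ n <= r.[w] <= S) ->
  S * u ^+ n <= r.[v].
  move=> /(_ v); rewrite (ltW v0) v1 => /(_ isT)/andP[+ _]; apply: le_trans.
  by rewrite ler_pM2l // lerXn2r // nnegrE ltW.
have Su0 : 0 <= S * u ^+ n by rewrite ltW // mulr_gt0 ?exprn_gt0.
have u0' := ltW u0.
apply: ler_pM => //; [exact: mulr_ge0| |exact: bnd padeQ_bounds].
by apply: ler_pM => //; exact: bnd padeP_bounds.
Qed.

End PadeError.

(** * From the approximants to inequalities for [w] *)

Lemma inv_le_ln1V (R : realType) (g : R) : 0 < g -> (g + 1)^-1 <= ln (g + 1) - ln g.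
Proof.
move=> g0; have g1 : 0 < g + 1 by rewrite addr_gt0.
have : ln (1 + - (g + 1)^-1) <= - (g + 1)^-1.
  by apply: le_ln1Dx; rewrite ltrN2 invf_lt1 // ltrDr.
rewrite (_ : 1 - _ = g / (g + 1)); last by field; rewrite gt_eqF.
by rewrite ln_div ?posrE // -opprB lerN2.
Qed.

(* Multiplying by the denominators turns the approximants into integers [P] and [Q] with
   [Q * w + 1 <= x * P * y]; compare the logarithms of both sides. *)
Lemma pade_gap (R : realType) (k n x y w D N : nat) : (1 < k)%N ->
  (0 < w)%N -> (0 < y)%N -> (0 < D)%N -> (0 < N <= D)%N ->
  (x ^ k = D.+1)%N -> (D * y ^ k = w ^ k + N)%N ->
  k%:R * w%:R <= (w%:R + 1) *
    ((pade_denom k n)%:R * w%:R * D.+1%:R ^+ n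
       / ((2 * n).+1%:R * 'C(2 * n, n)%:R * D%:R ^+ (2 * n).+1)
     + (pade_denom k n)%:R * 'C(2 * n, n)%:R * D.+1%:R ^+ n * D%:R / w%:R ^+ k.-1) :> R.
Proof.
move=> k1 w0 y0 D0 /andP[N0 ND] xk eqn.
have k0 : (0 < k)%N by lia.
have kR : k%:R != 0 :> R by rewrite pnatr_eq0; lia.
have x0 : (0 < x)%N by rewrite lt0n; apply/eqP => x0; move: xk; rewrite x0 exp0n.
have [wR yR xR DR] : [/\ 0 < w%:R :> R, 0 < y%:R :> R, 0 < x%:R :> R & 0 < D%:R :> R].
  by rewrite !ltr0n.
have BR : 0 < D.+1%:R :> R by rewrite ltr0n.
set M := pade_denom k n; set S : R := 'C(2 * n, n)%:R.
have M0 : 0 < M%:R :> R by rewrite ltr0n muln_gt0 expn_gt0 k0 part_gt0.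
have S0 : 0 < S by rewrite ltr0n bin_gt0; lia.
pose nu : R := k%:R^-1; pose u : R := D%:R / D.+1%:R.
have u01 : 0 < u <= 1.
  by rewrite divr_gt0 //= ler_pdivrMr // mul1r ler_nat leqW.
have nuE c : n%:R + c%:~R * nu = (n%:Z * k%:Z + c)%:~R / k%:R :> R.
  by rewrite intrD intrM /nu -!pmulrn; field.
have EQ : padeQ nu n = jacobi ((n%:Z * k%:Z - 1)%:~R / k%:R) ((n%:Z * k%:Z + 1)%:~R / k%:R) n.
  by rewrite -!nuE rmorphN1 mulN1r mul1r.
have EP : padeP nu n = jacobi ((n%:Z * k%:Z + 1)%:~R / k%:R) ((n%:Z * k%:Z - 1)%:~R / k%:R) n.
  by rewrite -!nuE rmorphN1 mulN1r mul1r.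
have [Q HQ] := jacobi_int R n (n%:Z * k%:Z - 1) (n%:Z * k%:Z + 1) D k0 (ltn0Sn D).
have [P HP] := jacobi_int R n (n%:Z * k%:Z + 1) (n%:Z * k%:Z - 1) D k0 (ltn0Sn D).
rewrite -EQ -/M -/u in HQ; rewrite -EP -/M -/u in HP.
set p := (padeP nu n).[u] in HP; set q := (padeQ nu n).[u] in HQ.
have p0 : 0 < p by exact: padeP_gt0.
have q0 : 0 < q by exact: padeQ_gt0.
have Bn0 : 0 < D.+1%:R ^+ n :> R by rewrite exprn_gt0.
have QR : 0 < Q%:~R :> R by rewrite -HQ !mulr_gt0.
have PR : 0 < P%:~R :> R by rewrite -HP !mulr_gt0.
pose delta : R := pade_log k n u.
have delta0 : 0 <= delta by exact: pade_log_ge0.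
have wk0 : 0 < w%:R ^+ k :> R by rewrite exprn_gt0.
have NR : 0 < N%:R :> R by rewrite ltr0n.
have eqnR : D%:R * y%:R ^+ k = w%:R ^+ k + N%:R :> R.
  by rewrite -!natrX -natrM eqn natrD.
have log_eq : k%:R * (ln (x%:R * P%:~R * y%:R) - ln (Q%:~R * w%:R)) =
              delta + ln (1 + N%:R / w%:R ^+ k).
  have -> : 1 + N%:R / w%:R ^+ k = D%:R * y%:R ^+ k / w%:R ^+ k :> R.
    by rewrite eqnR; field; rewrite gt_eqF.
  have lB : k%:R * ln x%:R = ln D.+1%:R :> R.
    by rewrite mulr_natl -lnXn // -natrX xk.
  have lu : ln u = ln D%:R - ln D.+1%:R by rewrite ln_div.
  rewrite -HP -HQ !(ln_div, lnM, lnXn) ?posrE ?mulr_gt0 ?exprn_gt0 ?divr_gt0 //.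
  rewrite /delta /pade_log -/nu -/p -/q lu -lB. ring.
(* The right side of [log_eq] is positive because [N > 0], and distinct integers differ by at least
   1. *)
have gap : Q%:~R * w%:R + 1 <= x%:R * P%:~R * y%:R :> R.
  have : Q%:~R * w%:R < x%:R * P%:~R * y%:R :> R.
    rewrite -ltr_ln ?posrE ?mulr_gt0 // -subr_gt0 -(pmulr_rgt0 _ (_ : 0 < k%:R)) ?ltr0n //.
    rewrite log_eq ltr_wpDl // ln_gt0 // ltrDl divr_gt0 //.
  have -> : Q%:~R * w%:R = (Q * w%:Z)%:~R :> R by rewrite intrM -!pmulrn.
  have -> : x%:R * P%:~R * y%:R = (x%:Z * P * y%:Z)%:~R :> R by rewrite !intrM -!pmulrn.
  by rewrite ltr_int -lezD1 -(ler_int R) intrD.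
set g : R := Q%:~R * w%:R in gap log_eq.
have g0 : 0 < g by rewrite mulr_gt0.
have gw : w%:R <= g.
  apply: ler_peMl; first exact: ltW.
  by rewrite ler1z -gtz0_ge1 -(ltr0z R).
have main : k%:R <= (g + 1) * (delta + N%:R / w%:R ^+ k).
  rewrite mulrC -ler_pdivrMr ?addr_gt0 //.
  apply: (@le_trans _ _ (delta + ln (1 + N%:R / w%:R ^+ k))); last first.
    rewrite lerD2l le_ln1Dx // (lt_trans (ltrN10 _)) // divr_gt0 //.
  rewrite -log_eq; apply: ler_wpM2l; first exact: ler0n.
  apply: le_trans (inv_le_ln1V g0) _; rewrite lerB // ler_ln ?posrE ?addr_gt0 //.
  by apply: lt_le_trans gap; rewrite addr_gt0.
have dle : delta <= D%:R^-1 ^+ (2 * n).+1 / ((2 * n).+1%:R * S ^+ 2).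
  have -> : D%:R^-1 = (1 - u) / u.
    rewrite /u -natr1; field; rewrite natr1; rewrite !gt_eqF //.
  exact: pade_log_le.
have Qle : Q%:~R <= M%:R * D.+1%:R ^+ n * S.
  rewrite -HQ ler_pM2l ?mulr_gt0 //.
  by have /andP[] := @padeQ_bounds R k n k1 u ltac:(by case/andP: u01 => /ltW-> ->).
(* From [w <= g] follows [(g + 1) * w <= (w + 1) * g]. *)
apply: (@le_trans _ _ ((w%:R + 1) * (g * (delta + N%:R / w%:R ^+ k)))).
  apply: (@le_trans _ _ ((g + 1) * (delta + N%:R / w%:R ^+ k) * w%:R)).
    by rewrite ler_pM2r.
  rewrite [leLHS]mulrAC mulrA; apply: ler_wpM2r.
    by rewrite addr_ge0 // divr_ge0 ?ltW.
  by rewrite !mulrDl !mul1r mulrC lerD2l.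
rewrite ler_pM2l ?addr_gt0 // mulrDr; apply: lerD.
  apply: (@le_trans _ _ ((M%:R * D.+1%:R ^+ n * S * w%:R)
      * (D%:R^-1 ^+ (2 * n).+1 / ((2 * n).+1%:R * S ^+ 2)))).
    apply: ler_pM => //; first exact: ltW.
    by rewrite ler_pM2r.
  have D2n : 0 < D%:R ^+ (2 * n).+1 :> R by rewrite exprn_gt0.
  have n0 : 0 < (2 * n).+1%:R :> R by rewrite ltr0n.
  rewrite le_eqVlt; apply/orP; left; apply/eqP; rewrite exprVn.
  move: (D%:R ^+ _.+1) ((2 * n).+1%:R) D2n n0 => e f e0 f0.
  by field; rewrite !gt_eqF.
have -> : w%:R ^+ k = w%:R * w%:R ^+ k.-1 :> R by rewrite -exprS prednK.
have wk1 : 0 < w%:R ^+ k.-1 :> R by rewrite exprn_gt0.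
have -> : g * (N%:R / (w%:R * w%:R ^+ k.-1)) = Q%:~R * N%:R / w%:R ^+ k.-1.
  by rewrite /g; field; rewrite !gt_eqF.
rewrite ler_pM2r ?invr_gt0 //.
by apply: ler_pM; [exact: ltW|exact: ler0n|rewrite mulrAC|rewrite ler_nat].
Qed.

Lemma central_bin_bounds n : (4 ^ n <= (2 * n).+1 * 'C(2 * n, n))%N /\ ('C(2 * n, n) <= 4 ^ n)%N.
Proof.
have rec m : (m.+1 * 'C(2 * m.+1, m.+1) = 2 * (2 * m).+1 * 'C(2 * m, m))%N.
  have E1 := mul_bin_diag (2 * m).+1 m.
  have E2 := mul_bin_left (2 * m).+1 m; have E3 := mul_bin_down (2 * m).+1 m.
  rewrite (_ : 2 * m.+1 = (2 * m).+2)%N; last by lia.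
  rewrite /= in E1 E3; rewrite binS mulnDr.
  have h : (m.+1 * 'C((2 * m).+1, m) = (2 * m).+1 * 'C(2 * m, m))%N.
    by rewrite [RHS]E3; congr (_ * _)%N; lia.
  lia.
elim: n => [|n [IH1 IH2]]; first by rewrite muln0 bin0.
have := rec n; move: IH1 IH2; set s := 'C(2 * n, n); set t := 'C(_, _); rewrite expnS.
set f := (4 ^ n)%N => IH1 IH2 E; split; last by nia.
suff : (n.+1 * (4 * f) <= n.+1 * ((2 * n.+1).+1 * t))%N by rewrite leq_pmul2l.
have -> : (n.+1 * ((2 * n.+1).+1 * t) = (2 * n.+1).+1 * (n.+1 * t))%N by lia.
rewrite E; nia.
Qed.

(* The index is the first [n] with [w <= c * rho ^+ n * D]. *)
Lemma gap_index (R : realType) (rho sigma D w c theta : R) (m e : nat) :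
  2 <= rho -> 0 < D -> 0 < c -> 0 <= sigma -> 0 <= theta ->
  sigma <= rho ^+ e -> c * rho ^+ m * D < w ->
  sigma ^+ m.+1 * D <= theta * (c * rho ^+ m * D) ^+ e ->
  exists n, w <= c * rho ^+ n * D /\ sigma ^+ n * D <= theta * w ^+ e.
Proof.
move=> rho2 D0 c0 s0 th0 srho mw base.
have rho0 : 0 < rho by lra.
have ex : exists n, w <= c * rho ^+ n * D.
  exists (Num.bound (w / (c * D))); rewrite mulrAC mulrC -ler_pdivrMr ?mulr_gt0 //.
  apply: le_trans (ltW (upper_nthrootP (leqnn _))) _.
  by rewrite lerXn2r // nnegrE; lra.
case: (ex_minnP ex) => n wn minn; exists n; split=> //.
have mn : (m < n)%N.
  rewrite ltnNge; apply/negP => nm; have := lt_le_trans mw wn.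
  rewrite ltr_pM2r // ltr_pM2l // ltNge ler_eXn2l ?nm //; lra.
have pw : c * rho ^+ n.-1 * D <= w.
  rewrite leNgt; apply/negP => /ltW/minn.
  by rewrite leqNgt ltn_predL (leq_ltn_trans (leq0n m)).
(* The starting condition absorbs [m.+1] factors [sigma], and [rho ^+ e] bounds each of the others;
   minimality of [n] puts [w] above the resulting power. *)
have En : n = (n - m.+1 + m.+1)%N by rewrite subnK.
rewrite {1}En exprD -mulrA.
apply: (@le_trans _ _ ((rho ^+ e) ^+ (n - m.+1) * (theta * (c * rho ^+ m * D) ^+ e))).
  apply: ler_pM => //; rewrite ?mulr_ge0 ?exprn_ge0 ?(ltW D0) //.
  by rewrite lerXn2r // nnegrE ?exprn_ge0 // ltW.
rewrite -exprM mulnC exprM mulrCA -exprMn.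
apply: ler_wpM2l => //; apply: lerXn2r.
- by rewrite nnegrE !mulr_ge0 ?exprn_ge0 ?ltW.
- by rewrite nnegrE (le_trans _ pw) // !mulr_ge0 ?exprn_ge0 ?ltW.
apply: le_trans pw; rewrite (_ : n.-1 = n - m.+1 + m)%N; last by rewrite {1}En addnS.
by rewrite exprD -!mulrA [_ * (c * _)]mulrCA.
Qed.

(** Bounding the central binomial coefficient by powers of 4 makes both error terms geometric in
    [n], as [gap_index] requires. *)
Lemma pade_gap_geometric (R : realType) (mu : R) (k n x y w D N : nat) : (1 < k)%N ->
  (0 < w)%N -> (0 < y)%N -> (0 < D)%N -> (0 < N <= D)%N ->
  (x ^ k = D.+1)%N -> (D * y ^ k = w ^ k + N)%N ->
  0 < mu -> (pade_denom k n)%:R <= mu ^+ n ->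
  k%:R * w%:R <= (w%:R + 1) *
    (w%:R / ((4 * D%:R ^+ 2 / (mu * D.+1%:R)) ^+ n * D%:R)
     + (4 * mu * D.+1%:R) ^+ n * D%:R / w%:R ^+ k.-1) :> R.
Proof.
move=> k1 w0 y0 D0 ND xk eqn mu0 Mmu.
have := pade_gap R n k1 w0 y0 D0 ND xk eqn => key; apply: le_trans key _.
have [wR DR BR] : [/\ 0 < w%:R :> R, 0 < D%:R :> R & 0 < D.+1%:R :> R] by rewrite !ltr0n.
have [S1 S2] := central_bin_bounds n.
have S1R : 4 ^+ n <= (2 * n).+1%:R * 'C(2 * n, n)%:R :> R by rewrite -natrX -natrM ler_nat.
have S2R : 'C(2 * n, n)%:R <= 4 ^+ n :> R by rewrite -natrX ler_nat.
have Bn : 0 < D.+1%:R ^+ n :> R by rewrite exprn_gt0.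
have mun : 0 < mu ^+ n by rewrite exprn_gt0.
have fn : 0 < 4 ^+ n :> R by rewrite exprn_gt0.
rewrite ler_pM2l ?addr_gt0 //; apply: lerD.
  have -> : w%:R / ((4 * D%:R ^+ 2 / (mu * D.+1%:R)) ^+ n * D%:R)
     = mu ^+ n * w%:R * D.+1%:R ^+ n / (4 ^+ n * D%:R ^+ (2 * n).+1).
    have D2n : 0 < (D%:R ^+ 2) ^+ n :> R by rewrite !exprn_gt0.
    rewrite [D%:R ^+ (2 * n).+1]exprSr exprM expr_div_n [(4 * _) ^+ n]exprMn [(mu * _) ^+ n]exprMn.
    move: (D%:R ^+ 2 ^+ n) D2n (D.+1%:R ^+ n) (mu ^+ n) (4 ^+ n) Bn mun fn => d2 d20 b m f b0 m0 f0.
    by field; rewrite !gt_eqF.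
  apply: ler_pM; rewrite ?mulr_ge0 ?exprn_ge0 ?invr_ge0 ?mulr_ge0 ?exprn_ge0 ?ler0n //.
    by rewrite ler_pM2r // ler_pM2r.
  rewrite lef_pV2 ?posrE ?mulr_gt0 ?exprn_gt0 ?ltr0n ?bin_gt0 ?leq_pmull //.
  by rewrite ler_pM2r // exprn_gt0.
rewrite ler_pM2r ?invr_gt0 ?exprn_gt0 // ler_pM2r // !exprMn [4 ^+ n * _]mulrC ler_pM2r //.
by apply: ler_pM; rewrite ?ler0n.
Qed.

(** * Covering all sizes of [w] *)

(** A suitable index makes the error terms at most 1 and 1/2, so [k * w <= 3/2 * (w + 1)],
    impossible for [k >= 4]. *)
Lemma no_solution_ge4 (R : realType) (k x y w D N : nat) : (3 < k)%N ->
  (0 < w)%N -> (0 < y)%N -> (0 < D)%N -> (0 < N <= D)%N ->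
  (x ^ k = D.+1)%N -> (D * y ^ k = w ^ k + N)%N ->
  (2 * k ^ 4 <= D.+1)%N -> (D ^ 2 < w ^ k)%N -> False.
Proof.
move=> k4 w0 y0 D0 ND xk eqn kD Dw.
have k1 : (1 < k)%N by apply: leq_trans k4.
pose K : R := k%:R; pose d : R := D%:R; pose W : R := w%:R.
have BE : D.+1%:R = d + 1 :> R by rewrite -natr1.
have d1 : 1 <= d by rewrite ler1n.
have W1 : 1 <= W by rewrite ler1n.
have K4 : 4 <= K by rewrite ler_nat.
have KB : 2 * K ^+ 4 <= d + 1 by rewrite -BE -natrX -natrM ler_nat.
have DW : d ^+ 2 < W ^+ k by rewrite -!natrX ltr_nat.
have key n := @pade_gap_geometric R (K ^+ 2) k n x y w D N k1 w0 y0 D0 ND xk eqn.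
have mu0 : 0 < K ^+ 2 by rewrite exprn_gt0 //; lra.
have Mle n : (pade_denom k n)%:R <= (K ^+ 2) ^+ n.
  by rewrite -exprM -natrX ler_nat pade_denom_le // ltnW.
have {}key n := key n mu0 (Mle n).
rewrite BE -/K -/d -/W in key.
have K2B : 32 * K ^+ 2 <= d + 1.
  have : 16 * K ^+ 2 <= K ^+ 4.
    have -> : K ^+ 4 = K ^+ 2 * K ^+ 2 by ring.
    by rewrite ler_pM2r //; nra.
  lra.
(* Index 0: if [w <= d], the error terms sum to less than 2. *)
have dW : d < W.
  rewrite ltNge; apply/negP => Wd.
  have := key 0%N; rewrite !expr0 !mul1r.
  have h1 : W / d <= 1 by rewrite ler_pdivrMr; lra.
  have W0 : 0 < W ^+ k.-1 by rewrite exprn_gt0 //; lra.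
  have h2 : d / W ^+ k.-1 < 1.
    rewrite ltr_pdivrMr // mul1r.
    have : d ^+ 2 < W * W ^+ k.-1 by rewrite -exprS prednK // ltnW.
    move: (W ^+ k.-1) W0 => V V0; nra.
  move: (W / d) (d / _) h1 h2 => s t h1 h2 h.
  have a1 : (W + 1) * (s + t) < (W + 1) * 2 by rewrite ltr_pM2l; lra.
  have a2 : 4 * W <= K * W by rewrite ler_pM2r; lra.
  suff : 0 < 0 :> R by rewrite ltxx.
  lra.
pose rho := 4 * d ^+ 2 / (K ^+ 2 * (d + 1)); pose sigma := 4 * K ^+ 2 * (d + 1).
have den0 : 0 < K ^+ 2 * (d + 1) by rewrite mulr_gt0 //; lra.
have den_le : 8 * (K ^+ 2 * (d + 1)) <= d ^+ 2.
  move: (K ^+ 2) mu0 K2B => L L0 LB; nra.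
have [n [wn sn]] : exists n, W <= 1 * rho ^+ n * d /\ sigma ^+ n * d <= 2^-1 * W ^+ 3.
  apply: (@gap_index R rho sigma d W 1 2^-1 0 3); rewrite ?expr0 ?mul1r ?expr1 //; try lra.
  - by rewrite /rho ler_pdivlMr //; lra.
  - by rewrite /sigma -mulrA; lra.
  (* The claim [sigma <= rho ^+ 3] becomes [(2 K^4)^2 (d + 1)^4 <= (2 d)^6], which follows from
     [2 K^4 <= d + 1 <= 2 d]. *)
  - rewrite /rho expr_div_n ler_pdivlMr ?exprn_gt0 //.
    rewrite /sigma -mulrA -mulrA -exprS.
    have -> : 4 * (K ^+ 2 * (d + 1)) ^+ 4 = (2 * K ^+ 4) ^+ 2 * (d + 1) ^+ 4 by ring.
    apply: (@le_trans _ _ ((d + 1) ^+ 2 * (d + 1) ^+ 4)).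
      rewrite ler_pM2r ?exprn_gt0 //; last by lra.
      by rewrite lerXn2r // ?nnegrE; nra.
    rewrite -exprD (_ : (4 * d ^+ 2) ^+ 3 = (2 * d) ^+ 6); last by ring.
    by rewrite lerXn2r // ?nnegrE; lra.
  - rewrite -subr_ge0.
    have -> : 2^-1 * d ^+ 3 - sigma * d = d * (d ^+ 2 / 2 - 4 * (K ^+ 2 * (d + 1))).
      by rewrite /sigma; field.
    by rewrite mulr_ge0 //; lra.
have := key n; rewrite -/rho -/sigma.
have W0 : 0 < W by lra.
have rn : 0 < rho ^+ n * d by move: wn; rewrite mul1r; apply: lt_le_trans.
have h1 : W / (rho ^+ n * d) <= 1 by rewrite ler_pdivrMr //; move: wn; rewrite !mul1r.
have h2 : sigma ^+ n * d / W ^+ k.-1 <= 2^-1.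
  rewrite ler_pdivrMr ?exprn_gt0 //; apply: (le_trans sn).
  rewrite ler_pM2l; last by lra.
  by rewrite ler_weXn2l // -ltnS prednK // ltnW.
move: (W / _) (_ / W ^+ _) h1 h2 => s t h1 h2 h.
have a1 : (W + 1) * (s + t) <= (W + 1) * (3 / 2) by rewrite ler_pM2l; lra.
have a2 : 4 * W <= K * W by rewrite ler_pM2r.
suff : 0 < 0 :> R by rewrite ltxx.
lra.
Qed.

(** The numerical hypotheses of [gap_index] for [k = 3], with [c = 2], [m = 1], [e = 2]. The
    constant 26/5 slightly exceeds the square root of 27. *)
Lemma growth_rates3 (R : realType) (d : R) : 728 <= d ->
  let rho := 4 * d ^+ 2 / (26 / 5 * (d + 1)) in let sigma := 4 * (26 / 5) * (d + 1) in
  [/\ 2 <= rho, 0 <= sigma, sigma <= rho ^+ 2, 2 * rho * d < 4 * d ^+ 2 &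
    sigma ^+ 2 * d <= 9 / 10 * (2 * rho * d) ^+ 2].
Proof.
move=> d728 rho sigma.
have den0 : 0 < 26 / 5 * (d + 1) by lra.
have rho_ge : 3 / 4 * d <= rho by rewrite /rho ler_pdivlMr //; nra.
have rho_le : rho <= 4 / 5 * d by rewrite /rho ler_pdivrMr //; nra.
have sig_le : sigma <= 21 * d by rewrite /sigma; lra.
have sig0 : 0 <= sigma by rewrite /sigma; lra.
have d0 : 0 <= d by lra.
have c0 : 0 <= 81 / 40 * d - 441 by lra.
move: rho sigma rho_ge rho_le sig_le sig0 {den0} => rho sigma rho_ge rho_le sig_le sig0.
split=> //; first lra.
- nra.
- nra.
apply: (@le_trans _ _ ((21 * d) ^+ 2 * d)).
  apply: ler_wpM2r => //; apply: lerXn2r; rewrite ?nnegrE //; lra.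
apply: (@le_trans _ _ (9 / 10 * (2 * (3 / 4 * d) * d) ^+ 2)).
  rewrite -subr_ge0.
  have -> : 9 / 10 * (2 * (3 / 4 * d) * d) ^+ 2 - (21 * d) ^+ 2 * d
    = d ^+ 3 * (81 / 40 * d - 441) by field.
  by rewrite mulr_ge0 ?exprn_ge0.
apply: ler_wpM2l; first lra.
have h : 2 * (3 / 4 * d) <= 2 * rho by lra.
have h0 : 0 <= 2 * (3 / 4 * d) by lra.
have h1 : 0 <= 2 * rho by lra.
apply: lerXn2r; [exact: mulr_ge0|exact: mulr_ge0|exact: ler_wpM2r].
Qed.

(** The error terms must now sum to less than about 3, and the final ones are 2 and 9/10. Indices 0
    and 1 are first used by hand to reach [4 * d ^+ 2 <= w], where [gap_index] can start. *)
Lemma no_solution_3 (R : realType) (x y w D N : nat) :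
  (0 < w)%N -> (0 < y)%N -> (0 < N <= D)%N ->
  (x ^ 3 = D.+1)%N -> (D * y ^ 3 = w ^ 3 + N)%N ->
  (727 < D)%N -> (D ^ 2 < w ^ 3)%N -> False.
Proof.
move=> w0 y0 ND xk eqn Dge Dw.
have D0 : (0 < D)%N by apply: leq_trans Dge.
pose d : R := D%:R; pose W : R := w%:R.
have BE : D.+1%:R = d + 1 :> R by rewrite -natr1.
have d728 : 728 <= d by rewrite (ler_nat _ 728).
have d0 : 0 < d by rewrite ltr0n.
have c0 : 0 <= 9 / 10 :> R by rewrite divr_ge0 // ler0n.
have W1 : 1 <= W by rewrite ler1n.
have DW : d ^+ 2 < W ^+ 3 by rewrite -!natrX ltr_nat.
have mu0 : 0 < 26 / 5 :> R by lra.
have Mle n : (pade_denom 3 n)%:R <= (26 / 5) ^+ n :> R.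
  have m0 : 0 <= (26 / 5) ^+ n :> R by rewrite exprn_ge0 // ltW.
  rewrite -(@ler_pXn2r _ 2) ?nnegrE ?ler0n //.
  rewrite -natrX; apply: (@le_trans _ _ (27 ^+ n)).
    by rewrite -natrX ler_nat pade_denom3_le.
  by rewrite -exprM mulnC exprM lerXn2r // ?nnegrE; lra.
have key n := @pade_gap_geometric R (26 / 5) 3 n x y w D N isT w0 y0 D0 ND xk eqn mu0 (Mle n).
rewrite BE -/d -/W /= in key.
(* Otherwise [d ^ 4 < w ^ 6 <= (8 d) ^ 3], so [d < 512]. *)
have W8 : 8 * d < W ^+ 2.
  rewrite ltNge; apply/negP => h.
  have : (d ^+ 2) ^+ 2 < (8 * d) ^+ 3.
    apply: (@lt_le_trans _ _ ((W ^+ 3) ^+ 2)).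
      have d2 : 0 <= d ^+ 2 by exact: sqr_ge0.
      by rewrite ltr_pXn2r // nnegrE // ltW // (le_lt_trans d2).
    by rewrite -exprM mulnC exprM lerXn2r // ?nnegrE ?exprn_ge0 //; lra.
  have -> : (d ^+ 2) ^+ 2 = d ^+ 3 * d by ring.
  have -> : (8 * d) ^+ 3 = d ^+ 3 * 512 by ring.
  rewrite ltr_pM2l ?exprn_gt0 //; lra.
have W76 : 76 <= W by nra.
have W0 : 0 < W by lra.
have step0 : 14 / 5 * d <= W.
  have := key 0%N; rewrite !expr0 !mul1r.
  have h2 : d / W ^+ 2 <= 1 / 8 by rewrite ler_pdivrMr ?exprn_gt0 //; lra.
  move=> h; suff : 14 / 5 <= W / d by rewrite ler_pdivlMr //; lra.
  move: (W / d) (d / _) h h2 => s t; nra.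
(* Index 1 with the exact denominator 3 and binomial coefficient 2, sharper than the geometric
   bounds. *)
have step1 : 4 * d ^+ 2 <= W.
  have Me : pade_denom 3 1 = 3%N by rewrite pade_denom3.
  have := @pade_gap R 3 1 x y w D N isT w0 y0 D0 ND xk eqn.
  rewrite Me (_ : 'C(2 * 1, 1) = 2)%N // BE -/d -/W !expr1 (_ : (2 * 1).+1 = 3)%N // [3.-1]/=.
  have h2 : 3 * 2 * (d + 1) * d / W ^+ 2 <= 77 / 100.
    rewrite ler_pdivrMr ?exprn_gt0 //; nra.
  rewrite (_ : 3 * W * (d + 1) / (3 * 2 * d ^+ 3) = W * (d + 1) / (2 * d ^+ 3)); last first.
    by field; rewrite gt_eqF //; lra.
  move=> h; suff : 11 / 5 <= W * (d + 1) / (2 * d ^+ 3).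
    rewrite ler_pdivlMr; last by rewrite mulr_gt0 ?exprn_gt0 //; lra.
    move=> h'; rewrite -(@ler_pM2r _ (d + 1)); last by lra.
    apply: le_trans h'; rewrite -subr_ge0.
    have -> : 11 / 5 * (2 * d ^+ 3) - 4 * d ^+ 2 * (d + 1) = d ^+ 2 * (2 / 5 * d - 4) by field.
    by rewrite mulr_ge0 ?exprn_ge0 //; lra.
  move: (W * (d + 1) / _) (_ / W ^+ 2) h h2 => s t; nra.
pose rho : R := 4 * d ^+ 2 / (26 / 5 * (d + 1)); pose sigma : R := 4 * (26 / 5) * (d + 1).
have [rho2 sigma0 sig_rho rho_d base] := growth_rates3 d728.
have [n [wn sn]] : exists n, W <= 2 * rho ^+ n * d /\ sigma ^+ n * d <= 9 / 10 * W ^+ 2.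
  apply: (@gap_index R rho sigma d W 2 (9 / 10) 1 2) => //.
  exact: lt_le_trans rho_d step1.
have := key n; rewrite -/rho -/sigma.
have rn : 0 < rho ^+ n * d.
  by rewrite mulr_gt0 ?exprn_gt0 // (lt_le_trans _ rho2) // ltr0n.
have h1 : W / (rho ^+ n * d) <= 2 by rewrite ler_pdivrMr // mulrA.
have h2 : sigma ^+ n * d / W ^+ 2 <= 9 / 10 by rewrite ler_pdivrMr // exprn_gt0.
move: (W / _) (_ / W ^+ _) h1 h2 => s t h1 h2 h.
have a1 : (W + 1) * (s + t) <= (W + 1) * (29 / 10) by rewrite ler_pM2l; lra.
suff : 0 < 0 :> R by rewrite ltxx.
lra.
Qed.

(** Supplies the size condition of [no_solution_ge4], as [x >= 5] and [x ^ k = D + 1]. *)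
Lemma two_pow4_le_pow5 k : (3 < k)%N -> (2 * k ^ 4 <= 5 ^ k)%N.
Proof.
elim: k => // k IHk; rewrite ltnS leq_eqVlt => /predU1P[<-//|k4].
have := IHk k4; rewrite [(5 ^ k.+1)%N]expnS; set f := (5 ^ k)%N => h.
apply: (@leq_trans (5 * (2 * k ^ 4))); last by rewrite leq_mul2l.
have k0 : (4 <= k)%N by [].
have -> : (k.+1 ^ 4 = k ^ 4 + 4 * k ^ 3 + 6 * k ^ 2 + 4 * k + 1)%N by lia.
have -> : (k ^ 4 = k * k ^ 3)%N by rewrite -expnS.
have h3 : (4 * k ^ 3 <= k * k ^ 3)%N by rewrite leq_mul2r k0 orbT.
have h2 : (16 * k ^ 2 <= k * k ^ 3)%N.
  by apply: leq_trans h3; rewrite [(k ^ 3)%N]expnS mulnA leq_mul2r; apply/orP; right; lia.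
have h1 : (64 * k <= k * k ^ 3)%N.
  apply: leq_trans h2; rewrite -[(k ^ 2)%N]mulnn mulnA leq_mul2r; apply/orP; right; lia.
lia.
Qed.

(** * Reduction of the theorem to the two exclusion lemmas *)

Lemma no_kth_power_triple_nat (k a b c x y z : nat) : (2 < k)%N -> (1 < a)%N ->
  (a ^ k < b)%N -> (b < c)%N ->
  (a ^ k * b + 1 = x ^ k)%N -> (a ^ k * c + 1 = y ^ k)%N -> (b * c + 1 = z ^ k)%N -> False.
Proof.
move=> k3 a2 ab bc Ex Ey Ez.
have k0 : (0 < k)%N by apply: leq_trans k3.
pose A := (a ^ k)%N; rewrite -/A in ab Ex Ey.
have A0 : (0 < A)%N by rewrite expn_gt0 (ltnW a2).
pose D := (A * b)%N; pose w := (a ^ 2 * z)%N; pose N := (D - A ^ 2)%N.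
have AE : ((a ^ 2) ^ k = A ^ 2)%N by rewrite /A -!expnM mulnC.
have wk : (w ^ k = A ^ 2 * z ^ k)%N by rewrite /w expnMn AE.
have D0 : (0 < D)%N by rewrite muln_gt0 A0 (leq_ltn_trans _ ab).
have AD : (A ^ 2 < D)%N by rewrite -mulnn ltn_pmul2l.
have root_gt0 r s : (s + 1 = r ^ k)%N -> (0 < r)%N.
  by case: r => //; rewrite exp0n // addn1.
have z0 := root_gt0 _ _ Ez; have y0 := root_gt0 _ _ Ey.
have w0 : (0 < w)%N by rewrite muln_gt0 z0 expn_gt0 (ltnW a2).
have ND : (0 < N <= D)%N by rewrite subn_gt0 AD leq_subr.
have xk : (x ^ k = D.+1)%N by rewrite -Ex addn1.
(* Expands [A b (A c + 1) = A^2 (b c + 1) + (A b - A^2)]. *)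
have eqn : (D * y ^ k = w ^ k + N)%N.
  rewrite wk -Ey -Ez !mulnDr !muln1 -addnA subnKC; last exact: ltnW.
  by rewrite /D -mulnn; lia.
have Dw : (D ^ 2 < w ^ k)%N.
  rewrite wk -Ez /D expnMn ltn_mul2l expn_gt0 A0 /= addn1 ltnS.
  by rewrite leq_mul2l (ltnW bc) orbT.
have xa : (a ^ 2 < x)%N.
  by rewrite -(ltn_exp2r _ _ k0) AE xk ltnS ltnW.
have [k4|k_le3] := ltnP 3 k.
  apply: (@no_solution_ge4 Rdefinitions.R k x y w D N) => //.
  rewrite -xk; apply: leq_trans (two_pow4_le_pow5 k4) _; rewrite leq_exp2r //.
  by apply: leq_trans xa; rewrite ltnS (@leq_exp2r 2 a 2).
have k3E : k = 3 by apply/eqP; rewrite eqn_leq k_le3.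
subst k; apply: (@no_solution_3 Rdefinitions.R x y w D N) => //.
(* This gives [D >= 9 ^ 3 - 1 = 728]. For [a >= 3] it follows from [x > a ^ 2]; [a = 2] needs a
   congruence. *)
have x9 : (9 <= x)%N.
  have [a3|a_le2] := ltnP 2 a.
    by apply: leq_trans (ltnW xa); rewrite (@leq_exp2r 3 a 2).
  have a2E : a = 2 by apply/eqP; rewrite eqn_leq a_le2.
  (* modulo 8 the cube of an odd number [x] is [x], and [x > 4] *)
  move: xa xk; rewrite /D /A a2E => xa xk.
  have x8 : (x %% 8 = 1)%N.
    have : ((x %% 8) ^ 3 %% 8 = 1)%N by rewrite modnXm xk -addn1 mulnC modnMDl.
    have : (x %% 8 < 8)%N by rewrite ltn_pmod.
    by case: (x %% 8)%N => [|[|[|[|[|[|[|[|]]]]]]]].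
  by have := divn_eq x 8; rewrite x8; case: (x %/ 8)%N => [|q]; lia.
by rewrite -ltnS -xk; apply: leq_trans (_ : 9 ^ 3 <= _)%N; rewrite // leq_exp2r.
Qed.

Theorem theorem1p1 (k : nat) (a b c : int) :
  (3 <= k)%N -> 1 < a -> a < b -> b < c -> a ^+ k < b ->
  ~ kth_dioph_triple k (a ^+ k) b c.
Proof.
move=> k3 a1 ab bc akb [[x Ex] [[y Ey] [z Ez]]].
have [a' Ea] : exists a', a = Posz a' by exists `|a|%N; rewrite gtz0_abs // (lt_trans _ a1).
have [b' Eb] : exists b', b = Posz b'.
  by exists `|b|%N; rewrite gtz0_abs // (lt_trans _ ab) // (lt_trans _ a1).
have [c' Ec] : exists c', c = Posz c'.
  by exists `|c|%N; rewrite gtz0_abs // (lt_trans _ bc) // (lt_trans _ ab) // (lt_trans _ a1).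
subst a b c.
have expz (m : nat) : (Posz m) ^+ k = Posz (m ^ k) by rewrite -!natz natrX.
rewrite !expz in akb Ex Ey.
(* The powers are positive, so the roots may be replaced by their absolute values. *)
apply: (@no_kth_power_triple_nat k a' b' c' `|x|%N `|y|%N `|z|%N) => //.
- by rewrite -abszX -Ex.
- by rewrite -abszX -Ey.
- by rewrite -abszX -Ez.
Qed.
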